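(* Let $\Omega\subseteq\mathbb{R}^n$ be closed and convex, let $f$ be a real-valued continuously differentiable function on $\Omega$, let $S\subseteq\mathbb{R}^q$, let $\sigma\in S$, and let $h_\sigma\in\mathcal{H}(f,\Omega,S)$ be a metric function associated to $f$. Let $x\in\Omega$ and let $$y = p(x;h_\sigma)=\arg\min_{z\in\Omega} h_\sigma(z,x).$$ Then $$\nabla f(x)^T(y-x)\le 0,$$ and equality holds if and only if $y=x$.
   Context: Setting: the problem is $\min_{x\in\Omega} f(x)$, where $\Omega\subseteq\mathbb{R}^n$ is closed and convex and $f$ is continuously differentiable. Metric function: let $S\subseteq\mathbb{R}^q$ be a set of parameters. A metric function associated to $f$ is any continuously differentiable function $h_\sigma:\Omega\times\Omega\to\mathbb{R}$ such that for any choice of the parameter $\sigma\in S$ the following hold ($\nabla_1$ denotes the gradient with respect to the first argument): (H1) $h_\sigma$ is convex with respect to its first argument, i.e. $h_\sigma(y,z)\ge h_\sigma(x,z)+\nabla_1 h_\sigma(x,z)^T(y-x)$ for all $x,y,z\in\Omega$, and for any $z\in\Omega$ the function $h_\sigma(\cdot,z)$ admits a unique minimum point (on $\Omega$); (H2) for any $x\in\Omega$ and any feasible direction $d\in\mathbb{R}^n$ at $x$ (i.e. $x+td\in\Omega$ for all sufficiently small $t>0$), $\nabla_1 h_\sigma(x,x)^T d=\nabla f(x)^T d$; (H3) $h_\sigma$ continuously depends on the parameter $\sigma$. The set of such metric functions is denoted $\mathcal{H}(f,\Omega,S)$. For $h_\sigma\in\mathcal{H}(f,\Omega,S)$ the associated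 generalized gradient projection operator $p(\,\cdot\,;h_\sigma):\Omega\to\Omega$ is $p(x;h_\sigma)=\arg\min_{z\in\Omega}h_\sigma(z,x)$. *)

(* Defs.v *)
(* R^n is 'cV[R]_n, over an arbitrary R : realType. *)
From HB Require Import structures.
From mathcomp Require Import all_boot all_order all_algebra.
From mathcomp Require Import all_classical all_reals all_analysis.
Export numFieldNormedType.Exports.

Set Implicit Arguments.
Unset Strict Implicit.
Unset Printing Implicit Defensive.

Import Order.TTheory GRing.Theory Num.Theory.
Local Open Scope classical_set_scope.
Local Open Scope ring_scope.

Definition dotmul (R : realType) (n : nat) (u v : 'cV[R]_n) : R :=
  (u^T *m v) 0 0.

Definition gradient (R : realType) (n : nat) (f : 'cV[R]_n -> R)
    (x : 'cV[R]_n) : 'cV[R]_n :=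
  \col_i 'D_(delta_mx i 0) f x.

(* A function on A is represented by a total function, of which nothing is
   required outside A other than what makes it differentiable at the points of
   A. The domains V used are R^n and R^n * R^n; in finite dimension, continuity
   of all the directional derivatives is continuity of the differential. *)
Definition C1_on (R : realType) (V : normedModType R) (A : set V)
    (f : V -> R) : Prop :=
  (forall x, A x -> differentiable f x) /\
  (forall v : V, {within A, continuous (fun x => 'D_v f x)}).

Definition gradient1 (R : realType) (n : nat)
    (g : 'cV[R]_n * 'cV[R]_n -> R) (x z : 'cV[R]_n) : 'cV[R]_n :=
  gradient (fun u => g (u, z)) x.

Definition argmin (R : realType) (T : Type) (A : set T) (g : T -> R) : set T :=
  [set y | A y /\ forall u, A u -> g y <= g u].

Definition feasible_direction (R : realType) (n : nat) (A : set 'cV[R]_n)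
    (x d : 'cV[R]_n) : Prop :=
  \forall t \near 0^'+, A (x + t *: d).

(* h is the whole family: h sigma (x, z) is h_sigma(x, z). *)
Record metric_function (R : realType) (n q : nat) (f : 'cV[R]_n -> R)
    (Omega : set 'cV[R]_n) (S : set 'cV[R]_q)
    (h : 'cV[R]_q -> 'cV[R]_n * 'cV[R]_n -> R) : Prop := MetricFunction {
  metric_C1 : forall sigma, S sigma -> C1_on (Omega `*` Omega) (h sigma);
  metric_convex : forall sigma x y z,
    S sigma -> Omega x -> Omega y -> Omega z ->
    h sigma (y, z) >=
      h sigma (x, z) + dotmul (gradient1 (h sigma) x z) (y - x);
  metric_unique_min : forall sigma z, S sigma -> Omega z ->
    exists! y, argmin Omega (fun u => h sigma (u, z)) y;
  metric_gradient : forall sigma x d,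
    S sigma -> Omega x -> feasible_direction Omega x d ->
    dotmul (gradient1 (h sigma) x x) d = dotmul (gradient f x) d;
  metric_continuous_param : forall x z, Omega x -> Omega z ->
    {within S, continuous (fun sigma => h sigma (x, z))}
}.

(* [get] picks an element of the argmin set; it is meaningful when that set is
   a singleton, as [metric_unique_min] guarantees at every x in Omega. *)
Definition gen_proj (R : realType) (n : nat) (Omega : set 'cV[R]_n)
    (g : 'cV[R]_n * 'cV[R]_n -> R) (x : 'cV[R]_n) : 'cV[R]_n :=
  get (argmin Omega (fun z => g (z, x))).

(* Main.v *)
(* Convexity of h_sigma(., x), evaluated at the minimizer y, gives
   h_sigma(x, x) + grad_1 h_sigma(x, x)^T (y - x) <= h_sigma(y, x) <= h_sigma(x, x),
   and y - x is a feasible direction, so grad_1 h_sigma(x, x) may be replaced by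
   grad f(x). When the linear term vanishes, x is also a minimizer, and the
   minimizer is unique. *)
Require Import Defs.
From mathcomp Require Import all_boot all_order all_algebra.
From mathcomp Require Import all_classical all_reals all_analysis.
Import Order.TTheory GRing.Theory Num.Theory.
Local Open Scope classical_set_scope.
Local Open Scope ring_scope.

Lemma dotmulv0 (R : realType) (n : nat) (u : 'cV[R]_n) : dotmul u 0 = 0.
Proof. by rewrite /dotmul mulmx0 mxE. Qed.

(** The point [x + t *: (y - x)] is the convex combination [t *: y + (1 - t) *: x], which stays in
    [A] for all t in [0, 1], hence for all small t > 0. *)
Lemma convex_feasible_direction (R : realType) (n : nat) (A : set 'cV[R]_n)
    (x y : 'cV[R]_n) :
  convex_set A -> A x -> A y -> feasible_direction A x (y - x).
Proof.
move=> cA Ax Ay; rewrite /feasible_direction; near=> t.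
have t01 : (0 <= t <= 1)%R by apply/andP; split; near: t;
  [exact: nbhs_right_ge | exact: nbhs_right_le].
have := cA y x (Itv01 (proj1 (andP t01)) (proj2 (andP t01))).
rewrite !inE => /(_ Ay Ax).
suff <- : t *: y + (1 - t) *: x = x + t *: (y - x) by [].
by rewrite scalerBl scale1r scalerBr addrCA.
Unshelve. all: by end_near. Qed.

Theorem proposition1 (R : realType) (n q : nat)
    (Omega : set 'cV[R]_n) (f : 'cV[R]_n -> R) (S : set 'cV[R]_q)
    (h : 'cV[R]_q -> 'cV[R]_n * 'cV[R]_n -> R)
    (sigma : 'cV[R]_q) (x y : 'cV[R]_n) :
  closed Omega -> convex_set Omega ->
  C1_on Omega f ->
  metric_function f Omega S h ->
  S sigma -> Omega x ->
  y = gen_proj Omega (h sigma) x ->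
  dotmul (gradient f x) (y - x) <= 0 /\
  (dotmul (gradient f x) (y - x) = 0 <-> y = x).
Proof.
move=> _ cvxO _ hH Ss Ox yE.
have [w [miw uniq_min]] := metric_unique_min hH Ss Ox.
have [Oy miny] : argmin Omega (fun z => h sigma (z, x)) y.
  by rewrite yE; apply: getI miw.
have fd : feasible_direction Omega x (y - x).
  exact: convex_feasible_direction.
have le_h := metric_convex hH Ss Ox Oy Ox.
rewrite (metric_gradient hH Ss Ox fd) in le_h.
split.
  by rewrite -(lerD2l (h sigma (x, x))) addr0 (le_trans le_h)// miny.
split=> [grad0|->]; last by rewrite subrr dotmulv0.
rewrite grad0 addr0 in le_h.
(* Uniqueness compares points only with the witness [w], so [y] is first replaced by [w]. Then [x]
   is a minimizer because [le_h] now bounds [h sigma (x, x)] by the minimum value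
   [h sigma (y, x)]. *)
rewrite -(uniq_min y (conj Oy miny)); apply: uniq_min.
by split=> // u Ou; apply: le_trans le_h (miny u Ou).
Qed.
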